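(* Let $G$ be a partially ordered group with identity $e$ and positive cone $G^+ = \{x\in G : x>e\}$. Let $\mathcal{J}$ be the set of all downward closed nonempty finite subsets of $G^+$, and for $A \subseteq G$ let $\sigma_{\mathcal{J}}(A) = \inf\{ |A\cap J|/|J| : J \in \mathcal{J}\}$. Let $h \ge 2$ and let $A_1, \dots, A_h$ be subsets of $G^+$ with $\sigma_{\mathcal{J}}(A_i) = \alpha_i$ for $i \in \{1,\dots,h\}$. Suppose that for every $J \in \mathcal{J}$, every $i \in \{1,\dots,h\}$ and every $x \in J \setminus A_i$, the set $A_i^*(x) = \{a \in A_i : a < x\} = A_i \cap (e,x)$ is nonempty and finite. Then \[ 1 - \sigma_{\mathcal{J}}(A_1\cdots A_h) \le \prod_{i=1}^h \bigl(1 - \sigma_{\mathcal{J}}(A_i)\bigr), \] where $A_1\cdots A_h = \{a_1\cdots a_h : a_i \in A_i \cup\{e\} \text{ for all } i\}$.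
   Context: A partially ordered group is a group $G$ with a partial order $\le$ such that $a \le b$ implies $ac \le bc$ and $ca \le cb$ for all $a,b,c \in G$. We write $x<y$ if $x \le y$ and $x\ne y$. For $x\in G$, $(e,x)=\{y\in G: e<y<x\}$. A subset $J \subseteq G^+$ is downward closed if $x \in J$ implies $(e,x) \subseteq J$. *)

(* Defs.v *)
From HB Require Import structures.
From mathcomp Require Import all_boot all_order all_algebra finmap.
From mathcomp Require Import boolp classical_sets cardinality reals.

Set Implicit Arguments.
Unset Strict Implicit.
Unset Printing Implicit Defensive.

Local Open Scope classical_set_scope.
Local Open Scope group_scope.

HB.mixin Record Group_POrder_isPOrderedGroup d G
    of Group G & Order.POrder d G := {
  le_mulg2r : forall c a b : G, (a <= b)%O -> (a * c <= b * c)%O;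
  le_mulg2l : forall c a b : G, (a <= b)%O -> (c * a <= c * b)%O
}.

#[short(type="porderGroupType")]
HB.structure Definition POrderedGroup d :=
  {G of Group_POrder_isPOrderedGroup d G & Group G & Order.POrder d G}.

Section PartiallyOrderedGroup.
Context {d : Order.disp_t} {G : porderGroupType d}.
Implicit Types (A J : set G) (x : G).

Definition poscone : set G := [set x | (1 < x)%O].

Definition below x : set G := [set y | (1 < y)%O /\ (y < x)%O].

Definition downward_closed J := forall x, J x -> below x `<=` J.

Definition dcfamily : set (set G) :=
  [set J | [/\ J `<=` poscone, downward_closed J, J !=set0 & finite_set J]].

(* The values lie in [0, 1], so this is a genuine infimum as soon as dcfamily
   is nonempty; if dcfamily is empty, the library's inf set0 = 0 applies. *)
Definition sigma (R : realType) A : R :=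
  inf [set (#|` fset_set (A `&` J)|%:R / #|` fset_set J|%:R)%R
      | J in dcfamily].

Definition lowerpart A x : set G := [set a | A a /\ (a < x)%O].

Definition prodset (h : nat) (A : 'I_h -> set G) : set G :=
  [set g | exists2 a : 'I_h -> G,
      forall i, (A i `|` [set 1]) (a i) & g = \prod_(i < h) a i].

End PartiallyOrderedGroup.

(* Main.v *)
Require Import Defs.
From mathcomp Require Import all_boot all_order all_algebra finmap.
From mathcomp Require Import boolp classical_sets cardinality reals.
From mathcomp Require Import lra.
Import Order.TTheory GRing.Theory Num.Theory.

Set Implicit Arguments.
Unset Strict Implicit.
Unset Printing Implicit Defensive.

Local Open Scope classical_set_scope.
Local Open Scope ring_scope.

(** The heart is the case of two factors: if 1 is in A and b |J| <= |B ∩ J| for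
    every finite downward closed J, then |A ∩ J| + b |J \ A| <= |AB ∩ J|.  Choose
    a maximal element a of A ∩ J.  No element of J above a lies in A, and
    translating {x in J : a < x} by a^-1 gives a finite downward closed set, in
    which B has density at least b; removing {x in J : a <= x} from J leaves a
    smaller downward closed set, so induction on |J| applies.  The bound says
    |J| - |AB ∩ J| <= (1 - b) (|J| - |A ∩ J|), which with b = sigma(B) gives the
    theorem for two factors; then induct on the number of factors. *)

Lemma card_fset_split (T : choiceType) (P : pred T) (J : {fset T}) :
  (#|` J| = #|` [fset x in J | P x]%fset| + #|` [fset x in J | ~~ P x]%fset|)%N.
Proof.
rewrite -(cardfsID [fset x in J | P x]%fset J).
by congr (_ + _)%N; congr #|` _|; apply/fsetP => x; rewrite !inE /=;
  case: (x \in J); case: (P x).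
Qed.

(** Either [a] is already maximal, or the elements of [S] strictly above [a] form a smaller nonempty
    set, whose maximal element stays maximal in [S] by transitivity. *)
Lemma exists_maximal_fset (d : Order.disp_t) (T : porderType d) (S : {fset T}) :
  S != fset0 -> exists2 a, a \in S & forall x, x \in S -> ~~ (a < x)%O.
Proof.
have [n] := ubnP #|` S|; elim: n S => // n IHn S leSn /fset0Pn[a aS].
have [S0|/IHn[|c]] := eqVneq [fset x in S | (a < x)%O]%fset fset0.
- exists a => // x xS; apply/negP => ax.
  by have := in_fset0 x; rewrite -S0 !inE /= xS ax.
- apply: leq_trans (fproper_ltn_card _) leSn.
  rewrite fproperEneq fset_sub andbT; apply/eqP => /fsetP/(_ a).
  by rewrite !inE /= aS ltxx.
- rewrite !inE /= => /andP[cS ac] cmax; exists c => // x xS.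
  apply/negP => cx; have := cmax x.
  by rewrite !inE /= xS (lt_trans ac cx) cx => /(_ isT).
Qed.

Section Density.
Context {R : realType} {d : Order.disp_t} {G : porderGroupType d}.
Implicit Types (A B : set G) (J : {fset G}).

(** Unlike [dcfamily], this admits the empty set: the pieces [J1] and [K] met in the induction below
    may be empty. *)
Definition lower_fset J :=
  [set` J] `<=` poscone /\ @downward_closed d G [set` J].

Definition count_in A J := #|` [fset x in J | x \in A]%fset|.

Lemma count_in_split A (P : pred G) J : (count_in A J =
  count_in A [fset x in J | P x]%fset + count_in A [fset x in J | ~~ P x]%fset)%N.
Proof.
rewrite /count_in (card_fset_split P).
by congr (_ + _)%N; congr #|` _|; apply/fsetP => x; rewrite !inE /= andbAC.
Qed.

Lemma count_in_le A B J : A `<=` B -> (count_in A J <= count_in B J)%N.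
Proof.
move=> AB; apply: fsubset_leq_card; apply/fsubsetP => x; rewrite !inE /=.
by case/andP => -> /set_mem/AB/mem_set.
Qed.

Lemma ltg_mul2l (c x y : G) : (x < y)%O -> (c * x < c * y)%g%O.
Proof.
rewrite !lt_neqAle => /andP[nxy /(le_mulg2l c) ->]; rewrite andbT.
by apply: contra nxy => /eqP/mulgI ->.
Qed.

(** Only the right factor gets 1 adjoined; the left one is meant to contain 1 already, as a partial
    product does. *)
Definition mulset1 A B : set G :=
  [set g | exists a c, [/\ A a, (B `|` [set 1%g]) c & g = (a * c)%g]].

Lemma count_in_mulset1 A B (b : R) J : A 1%g ->
  (forall J', lower_fset J' -> b * #|` J'|%:R <= (count_in B J')%:R) ->
  lower_fset J ->
  (count_in A J)%:R + b * (#|` J|%:R - (count_in A J)%:R)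
    <= (count_in (mulset1 A B) J)%:R.
Proof.
move=> A1 Bb; have [n] := ubnP #|` J|; elim: n J => // n IHn J leJn [Jpos Jdc].
have [A0|/exists_maximal_fset[a]] := eqVneq [fset x in J | x \in A]%fset fset0.
  (* If [A] misses [J], the claim is the density bound for [B], as 1 in [A] puts [B] inside the
     product. *)
  rewrite /(count_in A J) A0 cardfs0 add0r subr0.
  apply: le_trans (Bb J (conj Jpos Jdc)) _; rewrite ler_nat; apply: count_in_le.
  by move=> x Bx; exists 1%g, x; split=> //; [left | rewrite mul1g].
rewrite !inE /= => /andP[aJ aA] amax.
pose J1 := [fset x in J | ~~ (a <= x)%O]%fset.
pose U := [fset x in J | (a <= x)%O]%fset.
pose L := [fset x in J | (a < x)%O]%fset.
have EU : U = (a |` L)%fset.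
  by apply/fsetP => x; rewrite !inE /= le_eqVlt [a == x]eq_sym;
    case: eqVneq => // ->; rewrite aJ.
have aL : a \notin L by rewrite !inE /= ltxx andbF.
have cJ : (#|` J| = 1 + #|` L| + #|` J1|)%N.
  by rewrite (card_fset_split (>= a)%O) -/U EU cardfsU1 aL.
(* By maximality, [a] is the only element of [A] in [U]. *)
have cA : (count_in A J = 1 + count_in A J1)%N.
  rewrite (count_in_split A (>= a)%O) -/U -/J1; congr (_ + _)%N.
  apply/eqP/cardfs1P; exists a; apply/fsetP => x; rewrite !inE /=.
  apply/idP/eqP => [/andP[/andP[xJ]]|->]; last by rewrite aJ lexx aA.
  rewrite le_eqVlt => /predU1P[->//|ax] xA.
  by have := amax x; rewrite !inE /= xJ xA ax => /(_ isT).
have J1l : lower_fset J1.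
  split=> [x|x] /=; rewrite !inE /= => /andP[xJ nax]; first exact: Jpos.
  move=> y yx; have := Jdc _ xJ _ yx; rewrite /= !inE => -> /=.
  by apply: contra nax => /le_trans; apply; case: yx => _ /ltW.
have J1n : (#|` J1| < n)%N.
  move: leJn; rewrite cJ ltnS add1n addSn; apply: leq_trans.
  by rewrite ltnS leq_addl.
pose K := [fset (a^-1 * x)%g | x in L]%fset.
have KP y : (y \in K) = ((a * y)%g \in L).
  apply/imfsetP/idP => [[x xL ->]|ayL]; first by rewrite mulVKg.
  by exists (a * y)%g => //; rewrite mulKg.
have cK : #|` K| = #|` L| by rewrite card_imfset //; exact: mulgI.
have Kl : lower_fset K.
  split=> [x|x] /=; rewrite KP !inE /= => /andP[axJ axa].
    by move/(ltg_mul2l a^-1%g): axa; rewrite mulVg mulKg.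
  move=> y [y1 yx]; rewrite /= KP !inE /=.
  (* Since [1 < a], the product [a * y] is positive and lies below [a * x], hence in [J]. *)
  have aay : (a < a * y)%g%O by rewrite -{1}(mulg1 a) ltg_mul2l.
  rewrite aay andbT; apply: (Jdc _ axJ); split; last exact: ltg_mul2l.
  exact: lt_trans (Jpos _ aJ) aay.
(* The part of the product set in [U] contains [a = a * 1] and the translate by [a] of the elements
   of [B] in [K], which avoids [a]. *)
have cAB : (1 + count_in B K + count_in (mulset1 A B) J1
    <= count_in (mulset1 A B) J)%N.
  rewrite (count_in_split (mulset1 A B) (>= a)%O J) -/U -/J1 leq_add2r.
  pose M := [fset (a * y)%g | y in [fset y in K | y \in B]%fset]%fset.
  have cM : #|` M| = count_in B K by rewrite card_imfset //; exact: mulgI.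
  have aM : a \notin M.
    apply: contra aL => /imfsetP[y /=]; rewrite in_fset => /andP[yK _] {1}->.
    by rewrite -KP.
  rewrite -cM; have -> : (1 + #|` M| = #|` a |` M|%fset)%N by rewrite cardfsU1 aM.
  apply: fsubset_leq_card; apply/fsubsetP => x; rewrite EU in_fset1U.
  case/predU1P => [->|/imfsetP[y /=]].
    rewrite !inE /= eqxx /=; apply: mem_set; exists a, 1%g.
    by split; [exact: set_mem | right | rewrite mulg1].
  rewrite !inE /= KP !inE => /andP[ayL /set_mem yB] ->.
  rewrite ayL orbT /=; apply: mem_set; exists a, y.
  by split; [exact: set_mem | left |].
(* The point [a] adds 1 to both counts and cancels in [|J| - |A ∩ J|], which thus grows by
   [|L| = |K|] over its value for [J1]. *)
have := IHn J1 J1n J1l; have := Bb K Kl; move: cAB.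
rewrite cJ cA cK -(ler_nat R) !natrD; lra.
Qed.

Lemma dcfamily_fset (J : set G) : dcfamily J ->
  [/\ lower_fset (fset_set J), (0 < #|` fset_set J|)%N &
    forall A, #|` fset_set (A `&` J)| = count_in A (fset_set J)].
Proof.
case=> Jpos Jdc [x Jx] Jfin.
split; first by rewrite /lower_fset fset_setK.
  by rewrite cardfs_gt0; apply/fset0Pn; exists x; rewrite in_fset_set ?inE.
move=> A; congr #|` _|; apply/fsetP => y.
rewrite in_fset_set; last exact: finite_setIr.
by rewrite !inE /= in_fset_set // in_setI andbC.
Qed.

Lemma sigma_ratio_ge0 A : lbound
  [set (#|` fset_set (A `&` J)|%:R / #|` fset_set J|%:R : R) | J in dcfamily] 0.
Proof. by move=> _ [J _ <-]; rewrite divr_ge0. Qed.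

Lemma sigma_ge0 A : 0 <= sigma R A.
Proof.
rewrite /sigma; set E := (X in inf X).
have [->|/set0P E0] := eqVneq E set0; first by rewrite inf0.
by apply: lb_le_inf E0 _; exact: sigma_ratio_ge0.
Qed.

Lemma sigma_count A J : lower_fset J ->
  sigma R A * #|` J|%:R <= (count_in A J)%:R.
Proof.
move=> [Jpos Jdc]; have [J0|] := eqVneq J fset0.
  by rewrite {1}J0 cardfs0 mulr0 ler0n.
move=> /[dup] Jn0; rewrite -cardfs_gt0 => Jgt0.
rewrite -ler_pdivlMr ?ltr0n //.
apply: ge_inf; first by exists 0; exact: sigma_ratio_ge0.
exists [set` J].
  by split=> //; case/fset0Pn: Jn0 => x xJ; exists x.
rewrite set_fsetK; congr (_%:R / _); congr #|` _|; apply/fsetP => y.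
rewrite in_fset_set; last exact: finite_setIr.
by rewrite in_setI !inE /= andbC mem_setE.
Qed.

Lemma sigma_le1 A : sigma R A <= 1.
Proof.
have [D0|/set0P[J DJ]] := eqVneq (@dcfamily d G) set0.
  by rewrite /sigma D0 image_set0 inf0.
have [Jl Jgt0 _] := dcfamily_fset DJ.
rewrite -(@ler_pM2r _ #|` fset_set J|%:R) ?ltr0n // mul1r.
apply: le_trans (sigma_count A Jl) _; rewrite ler_nat.
by apply: fsubset_leq_card; apply/fsubsetP => x; rewrite !inE => /andP[].
Qed.

Lemma sigma_mulset1 A B : A 1%g ->
  1 - sigma R (mulset1 A B) <= (1 - sigma R A) * (1 - sigma R B).
Proof.
move=> A1; have [D0|/set0P[J0 DJ0]] := eqVneq (@dcfamily d G) set0.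
  (* With no admissible [J], every density is 0 by the convention for [inf set0], and the claim
     reads 1 <= 1. *)
  by rewrite /sigma D0 !image_set0 inf0 subr0 mulr1.
have B1 := sigma_le1 B.
suff : 1 - (1 - sigma R A) * (1 - sigma R B) <= sigma R (mulset1 A B) by lra.
apply: lb_le_inf; first by eexists; exists J0.
move=> _ [J DJ <-]; have [Jl Jgt0 cJ] := dcfamily_fset DJ.
rewrite cJ ler_pdivlMr ?ltr0n //.
have := count_in_mulset1 A1 (sigma_count B) Jl.
(* The counting bound is [(1 - b) |A ∩ J| + b |J|] with [b = sigma R B]; as [1 - b >= 0], [|A ∩ J|]
   may be replaced by its lower bound [sigma R A * |J|]. *)
have := ler_wpM2l _ (sigma_count A Jl) => /(_ (1 - sigma R B)).
rewrite subr_ge0 => /(_ B1); lra.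
Qed.

Lemma prodset1 h (A : 'I_h -> set G) : prodset A 1%g.
Proof. by exists (fun=> 1%g) => [i|]; [right | rewrite big1]. Qed.

Lemma prodset_recr h (A : 'I_h.+1 -> set G) :
  prodset A =
  mulset1 (prodset (fun i : 'I_h => A (widen_ord (leqnSn h) i))) (A ord_max).
Proof.
apply/seteqP; split=> [g [a aA ->]|g [x [c [[a aA ->] cA ->]]]].
  rewrite big_ord_recr /=; eexists; exists (a ord_max).
  by split=> //; exists (fun i => a (widen_ord (leqnSn h) i)).
(* The tuple [a] is extended by [c] at the last index. *)
exists (fun i : 'I_h.+1 => if unlift ord_max i is Some j then a j else c).
  have lw (j : 'I_h) : lift ord_max j = widen_ord (leqnSn h) j.
    by apply: val_inj; rewrite /= /bump leqNgt ltn_ord.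
  by move=> i; case: unliftP => [j ->|-> //]; rewrite lw; exact: aA.
rewrite big_ord_recr /= unlift_none; congr (_ * _)%g.
apply: eq_bigr => j _; rewrite (_ : widen_ord _ j = lift ord_max j) ?liftK //.
by apply: val_inj; rewrite /= /bump leqNgt ltn_ord.
Qed.

Lemma sigma_prodset h (A : 'I_h -> set G) :
  1 - sigma R (prodset A) <= \prod_(i < h) (1 - sigma R (A i)).
Proof.
elim: h A => [|h IHh] A; first by rewrite big_ord0 gerBl sigma_ge0.
rewrite prodset_recr big_ord_recr /=.
apply: le_trans (sigma_mulset1 _ (prodset1 _)) _.
by rewrite ler_wpM2r ?subr_ge0 ?sigma_le1.
Qed.

End Density.

Theorem theorem3p3 (R : realType) (d : Order.disp_t) (G : porderGroupType d)
    (h : nat) (hh : (2 <= h)%N) (A : 'I_h -> set G) (alpha : 'I_h -> R)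
    (A_pos : forall i, A i `<=` poscone)
    (A_sigma : forall i, sigma R (A i) = alpha i)
    (A_lower : forall J : set G, dcfamily J ->
       forall (i : 'I_h) (x : G), (J `\` A i) x ->
       lowerpart (A i) x !=set0 /\ finite_set (lowerpart (A i) x)) :
  1 - sigma R (prodset A) <= \prod_(i < h) (1 - sigma R (A i)).
Proof. exact: sigma_prodset. Qed.
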